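(* Suppose $g$ is a hyperbolic automorphism of a locally finite $\delta$-hyperbolic graph $\Gamma$. Then there exist a bi-infinite geodesic $\gamma:\mathbb R\to\Gamma$ and $n\in\mathbb N$ such that $g^n$ acts by translation along $\gamma$, i.e. there is $\ell\in\mathbb R$ with $g^n(\gamma(t))=\gamma(t+\ell)$ for all $t\in\mathbb R$.
   Context: $\mathbb N=\{1,2,\dots\}$. A graph has a countable vertex set and a symmetric, diagonal-free edge set; edges are identified with unit intervals, giving the path metric. Locally finite means each vertex is adjacent to finitely many vertices. A geodesic metric space $X$ is $\delta$-hyperbolic ($\delta\ge0$) if each side of every geodesic triangle lies in the $\delta$-neighbourhood of the union of the other two sides (and $\delta$ is taken large enough that $(x\mid y)_p\ge\min\{(x\mid z)_p,(y\mid z)_p\}-\delta$ for all $x,y,z,p$, where $(x\mid y)_p=\frac12(d(x,p)+d(y,p)-d(x,y))$); in particular a $\delta$-hyperbolic graph is connected. A bi-infinite geodesic is an isometric embedding $\mathbb R\to\Gamma$. The hyperbolic boundary $\partial X$ is the set of infinite geodesic rays modulo finite Hausdorff distance. An isometry $g$ of $X$ is elliptic if it has a bounded orbit; it is hyperbolic if it is not elliptic and fixes precisely two distinct points of $\partial X$. *)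

(* Defs.v *)
From HB Require Import structures.
From mathcomp Require Import all_boot all_order all_algebra.
From mathcomp Require Import all_classical all_reals.
From mathcomp Require Import topology.

Set Implicit Arguments.
Unset Strict Implicit.
Unset Printing Implicit Defensive.

Import Order.TTheory GRing.Theory Num.Theory.

Local Open Scope classical_set_scope.
Local Open Scope ring_scope.

Section MetricGeometry.
Context {R : realType} {X : metricType R}.
Implicit Types (x y z p : X) (A B : set X) (c r : R -> X) (f : X -> X).

Definition gromov_product x y p : R :=
  (mdist x p + mdist y p - mdist x y) / 2.

(* The closed neighbourhood, with the distance to A attained. The sides of a
   triangle are compact, so below this is the same as "distance to A at most
   e"; an open neighbourhood would make 0-hyperbolicity unsatisfiable. *)
Definition neighbourhood (e : R) A : set X :=
  [set x | exists2 a, A a & mdist x a <= e].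

(* The values of c outside [0, l] are irrelevant; likewise those of a ray at
   negative arguments. *)
Definition geodesic_segment c (l : R) x y : Prop :=
  [/\ 0 <= l, c 0 = x, c l = y &
      forall s t, 0 <= s <= l -> 0 <= t <= l -> mdist (c s) (c t) = `|s - t|].

Definition geodesic_side A x y : Prop :=
  exists c l, geodesic_segment c l x y /\ A = c @` [set t | 0 <= t <= l].

Definition bi_infinite_geodesic c : Prop :=
  forall s t, mdist (c s) (c t) = `|s - t|.

Definition geodesic_ray r : Prop :=
  forall s t, 0 <= s -> 0 <= t -> mdist (r s) (r t) = `|s - t|.

Definition ray_image r : set X := r @` [set t | 0 <= t].

Definition finite_hausdorff_distance A B : Prop :=
  exists K, A `<=` neighbourhood K B /\ B `<=` neighbourhood K A.

Definition ray_class r : set (R -> X) :=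
  [set r' | geodesic_ray r' /\
            finite_hausdorff_distance (ray_image r) (ray_image r')].

Definition is_isometry f : Prop :=
  (forall x y, mdist (f x) (f y) = mdist x y) /\ (forall y, exists x, f x = y).

(* The orbit under all integer powers of the bijection f. *)
Definition orbitZ f x : set X :=
  [set y | exists n, y = iter n f x \/ x = iter n f y].

Definition elliptic f : Prop :=
  exists x, exists M, forall y z, orbitZ f x y -> orbitZ f x z -> mdist y z <= M.

End MetricGeometry.

Section Hyperbolicity.
Context {R : realType} (X : metricType R).

Definition geodesic_space : Prop :=
  forall x y : X, exists c l, geodesic_segment c l x y.

Definition thin_triangles (delta : R) : Prop :=
  forall (x y z : X) (A B C : set X),
    geodesic_side A x y -> geodesic_side B y z -> geodesic_side C z x ->
    [/\ A `<=` neighbourhood delta (B `|` C),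
        B `<=` neighbourhood delta (C `|` A) &
        C `<=` neighbourhood delta (A `|` B)].

Definition gromov_four_point (delta : R) : Prop :=
  forall x y z p : X,
    Num.min (gromov_product x z p) (gromov_product y z p) - delta
      <= gromov_product x y p.

Definition hyperbolic_space (delta : R) : Prop :=
  [/\ 0 <= delta, geodesic_space, thin_triangles delta &
      gromov_four_point delta].

(* A boundary point is an equivalence class of rays, hence a set of maps. *)
Definition boundary : set (set (R -> X)) :=
  [set xi | exists2 r, geodesic_ray r & xi = ray_class r].

(* For an isometry f this sends the class of r to the class of f \o r. *)
Definition boundary_map (f : X -> X) (xi : set (R -> X)) : set (R -> X) :=
  [set f \o r | r in xi].

Definition hyperbolic_isometry (f : X -> X) : Prop :=
  [/\ is_isometry f, ~ elliptic f &
      exists a b, a <> b /\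
        [set xi | boundary xi /\ boundary_map f xi = xi] = [set a; b]].

End Hyperbolicity.

Record graph := Graph {
  vertex :> countType;
  adj : rel vertex;
  adj_sym : symmetric adj;
  adj_irrefl : irreflexive adj }.

Definition connected_graph (G : graph) : Prop :=
  forall u v : G, exists2 p, path (@adj G) u p & last u p = v.

Definition locally_finite (G : graph) : Prop :=
  forall u : G, finite_set [set v | adj u v].

Record automorphism (G : graph) := Automorphism {
  aut_fun :> G -> G;
  aut_inv : G -> G;
  autK : cancel aut_fun aut_inv;
  autVK : cancel aut_inv aut_fun;
  aut_adj : forall u v, adj (aut_fun u) (aut_fun v) = adj u v }.

(* Barycentric coordinates of the point (1 - t) u + t v. *)
Definition bary (R : realType) (G : graph) (u v : G) (t : R) : G -> R :=
  fun w => (1 - t) * (w == u)%:R + t * (w == v)%:R.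

(* Points of the graph with edges identified with unit intervals. The case
   u = v gives the vertices (all but isolated vertices also lie on edges).
   Connectedness does not enter the definition of points; it is a parameter
   because it makes the path metric finite, so that the metric structure below
   can be attached to this type. *)
Record realization (R : realType) (G : graph) (cG : connected_graph G) :=
  Realization {
    coord : G -> R;
    coordP : exists u v t,
      [/\ u = v \/ adj u v, 0 <= t <= 1 & coord = bary u v t] }.

Section PathMetric.
Context (R : realType) (G : graph) (cG : connected_graph G).
Local Notation X := (realization R cG).
Implicit Types (x y z : X) (u v : G).

HB.instance Definition _ := gen_eqMixin X.
HB.instance Definition _ := gen_choiceMixin X.

Lemma coord_inj x y : coord x = coord y -> x = y.
Proof.
case: x y => [x px] [y py] /= e; subst y.
by congr Realization; exact: Prop_irrelevance.
Qed.

(* A subsegment of length l of an edge, with ends x and y. *)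
Definition edge_segment x y (l : R) : Prop :=
  exists u v s t, adj u v /\
    [/\ 0 <= s <= 1, 0 <= t <= 1,
        coord x = bary u v s, coord y = bary u v t & l = `|s - t|].

Inductive polygonal_path : X -> X -> R -> Prop :=
| PathNil x : polygonal_path x x 0
| PathCons x y z k l : edge_segment x y k -> polygonal_path y z l ->
    polygonal_path x z (k + l).

Definition path_metric x y : R := inf [set l | polygonal_path x y l].

Lemma edge_segment_sym x y l : edge_segment x y l -> edge_segment y x l.
Proof.
move=> [u [v [s [t [uv [s01 t01 xE yE ->]]]]]].
by exists u, v, t, s; split=> //; split=> //; rewrite distrC.
Qed.

Lemma polygonal_path_cat x y z k l :
  polygonal_path x y k -> polygonal_path y z l -> polygonal_path x z (k + l).
Proof.
elim=> [w|x1 y1 z1 k1 l1 e _ IH] p; first by rewrite add0r.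
by rewrite -addrA; apply: PathCons e (IH p).
Qed.

Lemma polygonal_path_sym x y l : polygonal_path x y l -> polygonal_path y x l.
Proof.
elim=> [w|x1 y1 z1 k1 l1 /edge_segment_sym e _ IH]; first exact: PathNil.
rewrite addrC; apply: polygonal_path_cat IH _.
by rewrite -[k1]addr0; apply: PathCons e (PathNil _).
Qed.

Lemma coord_lip x y l w : polygonal_path x y l -> `|coord x w - coord y w| <= l.
Proof.
elim=> [z|x1 y1 z1 k1 l1 e _ IH]; first by rewrite subrr normr0.
rewrite -(subrKA (coord y1 w)) (le_trans (ler_normD _ _))// lerD//.
case: e => u [v [s [t [uv [_ _ -> -> ->]]]]]; rewrite /bary.
have uDv : u != v by apply/eqP => uv'; move: uv; rewrite uv' adj_irrefl.
have [->|wu] := eqVneq w u.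
  rewrite (negbTE uDv) !mulr0 !addr0 !mulr1 distrC.
  by rewrite opprB addrC addrA subrK.
rewrite !mulr0 !add0r -mulrBl normrM ler_piMr//.
by case: (w == v); rewrite ?normr1 ?normr0 ?ler01.
Qed.

Lemma polygonal_path_ge0 x y l : polygonal_path x y l -> 0 <= l.
Proof.
have [u _] := coordP x => p.
exact: le_trans (normr_ge0 _) (coord_lip u p).
Qed.

Lemma vertex_pointP (u : G) : exists u' v t,
  [/\ u' = v \/ adj u' v, 0 <= t <= 1 & bary u u 0 = bary u' v t :> (G -> R)].
Proof. by exists u, u, 0; rewrite lexx ler01; split=> //; left. Qed.

Definition vertex_point (u : G) : X := Realization cG (vertex_pointP u).

Lemma bary0 u v : bary u v 0 = bary u u 0 :> (G -> R).
Proof. by apply/funext => w; rewrite /bary !mul0r. Qed.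

Lemma bary1 u v : bary u v 1 = bary v v 0 :> (G -> R).
Proof.
by apply/funext => w; rewrite /bary subrr subr0 !mul0r addr0 add0r.
Qed.

Lemma baryxx u t : bary u u t = bary u u 0 :> (G -> R).
Proof. by apply/funext => w; rewrite /bary -!mulrDl !subrK. Qed.

Lemma polygonal_path_vertex x : exists u l, polygonal_path x (vertex_point u) l.
Proof.
have [u [v [t [uv t01 xE]]]] := coordP x; exists u.
case: uv => [uv|uv].
  have -> : x = vertex_point u by apply: coord_inj; rewrite xE -uv /= baryxx.
  by exists 0; exact: PathNil.
exists (`|t - 0| + 0); apply: PathCons (PathNil _).
by exists u, v, t, 0; split=> //; split; rewrite ?lexx ?ler01//= bary0.
Qed.

Lemma polygonal_path_exists x y : exists l, polygonal_path x y l.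
Proof.
have [u [k pk]] := polygonal_path_vertex x.
have [v [l pl]] := polygonal_path_vertex y.
suff [m pm] : exists m, polygonal_path (vertex_point u) (vertex_point v) m.
  exists (k + (m + l)); apply: polygonal_path_cat pk _.
  by apply: polygonal_path_cat pm _; exact: polygonal_path_sym.
have [p] := cG u v; clear.
elim: p u => [|w p IH] u /= => [_ ->|/andP[uw pw] lw].
  by exists 0; exact: PathNil.
have [m pm] := IH _ pw lw.
exists (`|0 - 1| + m); apply: PathCons pm.
exists u, w, 0, 1; split=> //=.
by rewrite (bary0 u w) (bary1 u w) !lexx ler01; split.
Qed.

Let lengths_neq0 x y : [set l | polygonal_path x y l] !=set0.
Proof. by have [l pl] := polygonal_path_exists x y; exists l. Qed.

Let lengths_lb x y : has_lbound [set l | polygonal_path x y l].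
Proof. by exists 0 => l /polygonal_path_ge0. Qed.

Lemma path_metric_le x y l : polygonal_path x y l -> path_metric x y <= l.
Proof. by move=> p; exact: (ge_inf (lengths_lb x y)) p. Qed.

Lemma path_metricxx x : path_metric x x = 0.
Proof.
apply/eqP; rewrite eq_le path_metric_le; last exact: PathNil.
by apply: (lb_le_inf (lengths_neq0 _ _)) => l /polygonal_path_ge0.
Qed.

Lemma path_metric_eq0 x y : path_metric x y = 0 -> x = y.
Proof.
move=> xy0; apply: coord_inj; apply/funext => w.
apply/eqP; rewrite -subr_eq0 -normr_le0 -xy0.
by apply: (lb_le_inf (lengths_neq0 _ _)) => l; exact: coord_lip.
Qed.

Lemma path_metric_sym x y : path_metric x y = path_metric y x.
Proof.
by congr inf; apply/seteqP; split=> l; exact: polygonal_path_sym.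
Qed.

Lemma path_metric_triangle y x z :
  path_metric x z <= path_metric x y + path_metric y z.
Proof.
rewrite -lerBlDr; apply: (lb_le_inf (lengths_neq0 _ _)) => k pk.
rewrite lerBlDr -lerBlDl; apply: (lb_le_inf (lengths_neq0 _ _)) => l pl.
by rewrite lerBlDl; apply: path_metric_le; exact: polygonal_path_cat pk pl.
Qed.

HB.instance Definition _ := @isMetric.Build R X path_metric
  path_metricxx path_metric_eq0 path_metric_sym path_metric_triangle.

Section AutomorphismAction.
Variable g : automorphism G.

Lemma bary_aut (u v : G) (t : R) :
  bary u v t \o aut_inv g = bary (g u) (g v) t.
Proof.
apply/funext => w; rewrite /bary /=.
by rewrite !(can2_eq (autVK g) (autK g)).
Qed.

Lemma aut_pointP x : exists u v t,
  [/\ u = v \/ adj u v, 0 <= t <= 1 & coord x \o aut_inv g = bary u v t].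
Proof.
have [u [v [t [uv t01 ->]]]] := coordP x.
exists (g u), (g v), t; rewrite bary_aut; split=> //.
by case: uv => [->|uv]; [left|right; rewrite aut_adj].
Qed.

(* The affine extension of g: it sends (1 - t) u + t v to
   (1 - t) g(u) + t g(v), cf. bary_aut. *)
Definition aut_action x : X := Realization cG (aut_pointP x).

End AutomorphismAction.

Definition automorphism_inv (g : automorphism G) : automorphism G.
Proof.
refine (@Automorphism G (aut_inv g) g (autVK g) (autK g) _).
by move=> u v; rewrite -(aut_adj g) !autVK.
Defined.

Lemma aut_actionK g :
  cancel (aut_action g) (aut_action (automorphism_inv g)).
Proof.
by move=> x; apply: coord_inj; apply/funext => w /=; rewrite autK.
Qed.

Lemma aut_actionVK g :
  cancel (aut_action (automorphism_inv g)) (aut_action g).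
Proof.
by move=> x; apply: coord_inj; apply/funext => w /=; rewrite autVK.
Qed.

Lemma polygonal_path_aut g x y l : polygonal_path x y l ->
  polygonal_path (aut_action g x) (aut_action g y) l.
Proof.
elim=> [z|x1 y1 z1 k1 l1 e _ IH]; first exact: PathNil.
apply: PathCons IH.
have [u [v [s [t [uv [s01 t01 xE yE ->]]]]]] := e.
exists (g u), (g v), s, t; rewrite aut_adj; split=> //.
by split=> //=; rewrite ?xE ?yE bary_aut.
Qed.

Lemma aut_action_isometry g : is_isometry (aut_action g).
Proof.
split=> [x y|y]; last by exists (aut_action (automorphism_inv g) y); exact: aut_actionVK.
congr inf; apply/seteqP; split=> l /=; last exact: polygonal_path_aut.
by move=> /(polygonal_path_aut (automorphism_inv g)); rewrite !aut_actionK.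
Qed.

End PathMetric.

Arguments aut_action R {G} cG g x.

(* Main.v *)
Require Import Defs.
From mathcomp Require Import all_boot all_order all_algebra.
From mathcomp Require Import all_classical all_reals.
From mathcomp Require Import topology.
From mathcomp Require Import lra zify.

Set Implicit Arguments.
Unset Strict Implicit.
Unset Printing Implicit Defensive.

Import Order.TTheory GRing.Theory Num.Theory.
Local Open Scope classical_set_scope.
Local Open Scope ring_scope.

(** The idea.  Let [f] be the action of the automorphism and, for a vertex [z],
let [displacement z a] be the distance from [z] to [f^a z].  If some [z] and
[n > 0] satisfy [displacement z (n * M) = M * displacement z n] for all [M],
then the translates by powers of [f^n] of a geodesic from [z] to [f^n z] fit
together to a bi-infinite geodesic, along which [f^n] is a translation
([translated_geodesic]).  So it is enough to find such [z] and [n].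

Take rays [r1], [r2] representing the two fixed boundary points.  Since the
rays are not equivalent, the Gromov products of their points seen from a vertex
[o] are bounded ([gromov_product_ray_bounded]), which means that [o] lies close
to every geodesic from a far point of [r1] to a far point of [r2].  The map
[f^k] sends the rays to equivalent rays, so [f^k o] also lies close to such
geodesics, and therefore within a distance [K], not depending on [k], of one of
the rays ([isometric_image_near_rays]).  Both rays run through vertices at unit
intervals ([ray_meets_vertices]); pulling back by
[f^k] a vertex of the rays near [f^k o] gives a vertex [y_k] in the ball of
radius [K] around [o], which is finite, and [f^k y_k] lies exactly on a ray.

By the pigeonhole principle there are a vertex [z], one of the rays and an
[n > 0] such that, for infinitely many [k], both [f^k z] and [f^(k + n) z] lie
on this ray ([pigeonhole_recurrence]).  Write [l] for [displacement z n].  Choose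
[M] such pairs whose segments, each of length [l], follow one another along the
ray.  The distance between the two extreme orbit points is then [M * l] plus the
lengths of the gaps.  On the other hand powers of [f] commute, so one may travel
the same total power of [f] by performing the [M] steps [f^n] at once and the
gaps afterwards; by the triangle inequality the distance is at most
[displacement z (n * M)] plus the lengths of the gaps.  Hence
[displacement z (n * M) >= M * l], and the converse inequality is clear
([displacementMn_ray], [displacementMn_two_rays]).  The case [l = 0] does not
occur, because a periodic point would make [f] elliptic. *)

(** * Integer powers of a bijection *)

Section IntegerPowers.
Context {T : Type} (f fi : T -> T) (fK : cancel f fi) (fiK : cancel fi f).

(** The inverse [fi] is explicit data, because for an automorphism it is
    again the action of an automorphism. *)
Definition zpow (a : int) : T -> T :=
  match a with Posz n => iter n f | Negz n => iter n.+1 fi end.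

Lemma zpowS a x : zpow (a + 1) x = f (zpow a x).
Proof.
case: a => [n|[|n]]; first by rewrite -PoszD addn1.
  by rewrite [X in zpow X](_ : _ = 0)//= fiK.
by rewrite [X in zpow X](_ : _ = Negz n); [rewrite /= fiK|lia].
Qed.

Lemma zpowD_nat a (n : nat) x : zpow (a + n%:Z) x = iter n f (zpow a x).
Proof.
elim: n => [|n IH]; first by rewrite addr0.
by rewrite -addn1 PoszD addrA zpowS IH addn1.
Qed.

Lemma zpow_iterC a (n : nat) x : zpow a (iter n f x) = iter n f (zpow a x).
Proof.
have fif k y : iter k fi (f y) = f (iter k fi y).
  by elim: k => //= k ->; rewrite fK fiK.
elim: n => //= n <-; case: a => k /=; first by rewrite -iterSr.
by rewrite fif fK fiK.
Qed.

Lemma zpowD a b x : zpow (a + b) x = zpow a (zpow b x).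
Proof.
case: b => n; first by rewrite zpowD_nat -zpow_iterC.
have {2}-> : a = a + Negz n + n.+1%:Z by rewrite NegzE subrK.
rewrite zpowD_nat -zpow_iterC; congr (zpow _ _).
by rewrite -zpowD_nat NegzE addNr.
Qed.

End IntegerPowers.

(** * Recurrence by the pigeonhole principle *)

Section Pigeonhole.

Lemma pigeonhole_unbounded (T : eqType) (s : seq T) (P : nat -> T -> Prop) :
  (forall N, exists k t, [/\ (N <= k)%N, t \in s & P k t]) ->
  exists t, forall N, exists2 k, (N <= k)%N & P k t.
Proof.
elim: s => [|t s IH] Ps; first by have [k [t []]] := Ps 0%N.
case: (pselect (forall N, exists2 k, (N <= k)%N & P k t)) => [Pt|].
  by exists t.
move=> /existsNP[N0 nPt]; apply: IH => N.
have [k [u [Nk us Pu]]] := Ps (maxn N N0).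
exists k, u; split=> //; first exact: leq_trans (leq_maxl _ _) Nk.
move: us; rewrite inE => /orP[/eqP ut|//].
by case: nPt; exists k; [exact: leq_trans (leq_maxr _ _) Nk|rewrite -ut].
Qed.

(** Any [size s + 1] consecutive indices contain two of the same colour.  The
    colour and the difference of the two indices range over a finite set, so
    one choice of them occurs arbitrarily far out. *)
Lemma pigeonhole_recurrence (T : eqType) (s : seq T) (c : nat -> T) :
  (forall k, c k \in s) ->
  exists n t, (0 < n)%N /\
    forall N, exists k, [/\ (N <= k)%N, c k = t & c (k + n)%N = t].
Proof.
move=> cs.
pose L := [seq (n, t) | n <- iota 1 (size s), t <- s].
pose P k (nt : nat * T) :=
  [/\ (0 < nt.1)%N, c k = nt.2 & c (k + nt.1)%N = nt.2].
have [|[n t] nt] := @pigeonhole_unbounded _ L P.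
  move=> N; pose b := [seq c (N + i)%N | i <- iota 0 (size s).+1].
  have bs : {subset b <= s} by move=> _ /mapP[i _ ->].
  have : ~~ uniq b.
    by apply/negP => /uniq_leq_size/(_ bs); rewrite size_map size_iota ltnn.
  move=> /(uniqPn (c 0%N))[i [j [ij]]].
  rewrite size_map size_iota => js.
  rewrite !(nth_map 0%N) ?size_iota ?(ltn_trans ij)// !nth_iota ?(ltn_trans ij)//.
  rewrite !add0n => cij.
  exists (N + i)%N, ((j - i)%N, c (N + i)%N).
  split; first exact: leq_addr.
    apply/allpairsP; exists ((j - i)%N, c (N + i)%N); split=> //=.
    by rewrite mem_iota; lia.
  split=> /=; [by rewrite subn_gt0|by []|].
  by rewrite -addnA subnKC// ltnW.
have [_ _ [n0 _ _]] := nt 0%N.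
exists n, t; split=> // N; have [k Nk [_ ck ckn]] := nt N.
by exists k.
Qed.

End Pigeonhole.

(** * Displacement along an orbit *)

Section OrbitAlongRay.
Context {R : realType} {X : metricType R} (f fi : X -> X).
Context (fK : cancel f fi) (fiK : cancel fi f).
Context (f_isom : forall x y, mdist (f x) (f y) = mdist x y).
Local Notation F := (zpow f fi).

Lemma zpow_isometric a x y : mdist (F a x) (F a y) = mdist x y.
Proof.
have fi_isom u v : mdist (fi u) (fi v) = mdist u v by rewrite -f_isom !fiK.
by case: a => n /=; [elim: n|rewrite fi_isom; elim: n] => //= n <-.
Qed.

Definition displacement z a : R := mdist z (F a z).

Lemma displacementE z a b : mdist (F a z) (F b z) = displacement z (b - a).
Proof.
rewrite /displacement -[RHS](zpow_isometric a) -(zpowD fK fiK).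
by rewrite addrC subrK.
Qed.

Lemma displacement0 z : displacement z 0 = 0.
Proof. by rewrite /displacement mdistxx. Qed.

Lemma displacementN z a : displacement z (- a) = displacement z a.
Proof. by rewrite -[- a]sub0r -displacementE metric_sym. Qed.

Lemma displacementD z a b :
  displacement z (a + b) <= displacement z a + displacement z b.
Proof.
rewrite (le_trans (metric_triangle _ (F a z) _))// displacementE.
by rewrite addrAC subrr add0r.
Qed.

Lemma displacementMn_le z a (n : nat) :
  displacement z (a * n%:Z) <= n%:R * displacement z a.
Proof.
elim: n => [|n IH]; first by rewrite mulr0 displacement0 mul0r.
rewrite -addn1 PoszD natrD mulrDr mulr1 mulrDl mul1r.
by rewrite (le_trans (displacementD _ _ _))// lerD2r.
Qed.

(** The segments from [f^a z] to [f^(a + s) z] can be chosen one after the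
    other along the ray [q], so that their lengths and those of the gaps add up;
    regrouping the same powers of [f] bounds the total by
    [displacement z (s * n)] plus the gaps.  The sign of [s] is free: the orbit
    may run along the ray in either direction. *)
Lemma displacementMn_ray (q : nat -> X) z (s : int) :
  (forall i j, mdist (q i) (q j) = `|i%:R - j%:R|) ->
  (forall B, exists a m m', [/\ (B <= m <= m')%N, F a z = q m &
                                F (a + s) z = q m']) ->
  forall n : nat, displacement z (s * n%:Z) = n%:R * displacement z s.
Proof.
move=> q_geod pairs n; apply/eqP; rewrite eq_le displacementMn_le/=.
have qB i j : (i <= j)%N -> mdist (q i) (q j) = j%:R - i%:R.
  by move=> ij; rewrite q_geod distrC ger0_norm// subr_ge0 ler_nat.
have [a0 [m0 [_ [_ Ea0 _]]]] := pairs 0%N.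
(* The displacement by [b - a0 - s * n] is a lower bound for the sum of the
   gaps between the first [n] segments. *)
have [b [m [m0m Eb mE]]] : exists b m, [/\ (m0 <= m)%N, F b z = q m &
    n%:R * displacement z s + displacement z (b - a0 - s * n%:Z)
      <= m%:R - m0%:R].
  elim: n => [|n [b [m [m0m Eb IH]]]].
    by exists a0, m0; split=> //; rewrite mulr0 !subrr displacement0 mul0r addr0.
  have [a [i [j [/andP[mi ij] Ea Eas]]]] := pairs m.
  exists (a + s), j; split=> //; first by lia.
  have sE : displacement z s = j%:R - i%:R.
    by rewrite -qB// -Ea -Eas displacementE addrAC subrr add0r.
  have gE : displacement z (a - b) = i%:R - m%:R.
    by rewrite -qB// -Ea -Eb displacementE.
  have := displacementD z (a - b) (b - a0 - s * n%:Z).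
  rewrite (_ : _ + _ = a + s - a0 - s * n.+1%:Z); last by lia.
  by rewrite -natr1; lra.
have : displacement z (b - a0) = m%:R - m0%:R.
  by rewrite -qB// -Ea0 -Eb displacementE.
have := displacementD z (b - a0 - s * n%:Z) (s * n%:Z).
by rewrite subrK; lra.
Qed.

End OrbitAlongRay.

Section OrbitOnTwoRays.
Context {R : realType} {X : metricType R} (f fi : X -> X).
Context (fK : cancel f fi) (fiK : cancel fi f).
Context (f_isom : forall x y, mdist (f x) (f y) = mdist x y).
Context (f_free : forall z n, (0 < n)%N -> iter n f z <> z).
Local Notation F := (zpow f fi).
Local Notation displacement := (displacement f fi).

Lemma orbit_map_inj z (k l : nat) : F k%:Z z = F l%:Z z -> k = l.
Proof.
wlog kl : k l / (k <= l)%N => [H|].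
  by move=> E; case: (leqP k l) => [|/ltnW] kl; [exact: H|apply/esym/H].
rewrite leq_eqVlt in kl; case/orP: kl => [/eqP//|kl] E.
case: (@f_free z (l - k)%N); first by rewrite subn_gt0.
apply/esym/(@mdist_positivity R X).
have := displacementE fK fiK f_isom z k l.
by rewrite E mdistxx subzn ?(ltnW kl)// => ->.
Qed.

(** Pigeonhole provides [z], [n] and a single ray containing both [f^k z] and
    [f^(k + n) z] for infinitely many [k].  Their positions on the ray are
    unbounded because the orbit of [z] is infinite, and infinitely many of the
    pairs are traversed in the same direction. *)
Lemma displacementMn_two_rays (q : bool -> nat -> X) (s : seq X) :
  (forall e i j, mdist (q e i) (q e j) = `|i%:R - j%:R|) ->
  (forall k : nat, exists e z m, z \in s /\ F k%:Z z = q e m) ->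
  exists z n, (0 < n)%N /\ forall M : nat,
    displacement z (n%:Z * M%:Z) = M%:R * displacement z n%:Z.
Proof.
move=> q_geod hit.
have /boolp.choice[c cP] (k : nat) : exists c : (bool * X) * nat,
    c.1.2 \in s /\ F k%:Z c.1.2 = q c.1.1 c.2.
  by have [e [z [m h]]] := hit k; exists ((e, z), m).
pose col k := (c k).1; pose m k := (c k).2.
have [|n [[e z] [n0 rec]]] :=
    @pigeonhole_recurrence _ [seq (e, z) | e <- [:: true; false], z <- s] col.
  move=> k; have [ks _] := cP k; apply/allpairsP; exists (col k).
  by split; [case: (col k).1|exact: ks|case: (col k)].
have mE k : col k = (e, z) -> F k%:Z z = q e (m k).
  by move=> ck; have [_] := cP k; rewrite -/(col k) ck.
(* Only finitely many orbit points lie in the first [B] places of the ray. *)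
have far B : exists k, [/\ col k = (e, z), col (k + n)%N = (e, z),
    (B <= m k)%N & (B <= m (k + n))%N].
  apply: contrapT => /forallNP near.
  pose P k (bv : bool * nat) := [/\ col (k + bv.1 * n)%N = (e, z) &
                                   m (k + bv.1 * n)%N = bv.2].
  have [|[b v] Pbv] := @pigeonhole_unbounded _
      [seq (b, v) | b <- [:: true; false], v <- iota 0 B] P.
    move=> N; have [k [Nk ck ckn]] := rec N.
    have [mk|mk] := ltnP (m k) B.
      exists k, (false, m k); split=> //; last by rewrite /P/= addn0.
      by apply/allpairsP; exists (false, m k); split; rewrite //= mem_iota.
    have [mkn|mkn] := ltnP (m (k + n)%N) B; last by case: (near k).
    exists k, (true, m (k + n)%N); split=> //; last by rewrite /P/= mul1n.
    by apply/allpairsP; exists (true, m (k + n)%N); split; rewrite //= mem_iota.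
  have [k _ [ck mk]] := Pbv 0%N; have [l kl [cl ml]] := Pbv k.+1.
  have /orbit_map_inj : F (k + b * n)%N%:Z z = F (l + b * n)%N%:Z z.
    by rewrite !mE// mk ml.
  by move=> /addIn kl'; move: kl; rewrite kl' ltnn.
exists z, n; split=> // M.
pose P B (b : bool) := exists k : nat,
  [/\ col k = (e, z), col (k + n)%N = (e, z),
    (B <= m k)%N, (B <= m (k + n))%N & (m k <= m (k + n))%N = b].
have [|[] bP] := @pigeonhole_unbounded _ [:: true; false] P.
- move=> N; have [k [ck ckn mk mkn]] := far N.
  exists N, (m k <= m (k + n))%N; split=> //; first by case: (_ <= _)%N.
  by exists k.
- apply: (displacementMn_ray fK fiK f_isom (q_geod e)) => B.
  have [B' BB' [k [ck ckn mk mkn kn]]] := bP B.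
  exists k%:Z, (m k), (m (k + n)%N); rewrite -PoszD !mE// kn.
  by rewrite (leq_trans BB').
- rewrite -[LHS](displacementN fK fiK f_isom) -mulNr.
  rewrite -[in RHS](displacementN fK fiK f_isom).
  apply: (displacementMn_ray fK fiK f_isom (q_geod e)) => B.
  have [B' BB' [k [ck ckn mk mkn /negbT]]] := bP B; rewrite -ltnNge => kn.
  exists (k + n)%N%:Z, (m (k + n)%N), (m k).
  by rewrite PoszD addrK -PoszD !mE// (ltnW kn) (leq_trans BB').
Qed.

End OrbitOnTwoRays.

(** * An invariant geodesic *)

Section InvariantGeodesic.
Context {R : realType} {X : metricType R} (f fi : X -> X).
Context (fK : cancel f fi) (fiK : cancel fi f).
Context (f_isom : forall x y, mdist (f x) (f y) = mdist x y).
Local Notation F := (zpow f fi).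

(** On the piece with index [k = floor (t / l)] the line is the translate of [c]
    by [f^(n * k)].  It is 1-Lipschitz by the triangle inequality; a
    shortcut between two of its points would give one between two points
    [f^(n * a) z], whose distances are exactly multiples of [l]. *)
Lemma translated_geodesic (z : X) (n : nat) (c : R -> X) (l : R) :
  0 < l -> geodesic_segment c l z (iter n f z) ->
  (forall M : nat, displacement f fi z (n%:Z * M%:Z) =
                   M%:R * displacement f fi z n%:Z) ->
  exists gamma, bi_infinite_geodesic gamma /\
    forall t, iter n f (gamma t) = gamma (t + l).
Proof.
move=> l0 [_ c0 cl c_geod] additive.
have dn : displacement f fi z n%:Z = l.
  by rewrite /displacement /= -cl -c0 c_geod ?lexx ?(ltW l0)//
    sub0r normrN gtr0_norm.
pose k (t : R) := Num.floor (t / l); pose u t := t - (k t)%:~R * l.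
have u_itv t : 0 <= u t < l.
  have /andP[] := floor_itv (t / l); rewrite -/(k t).
  by rewrite intrD1 ler_pdivlMr// ltr_pdivrMr// mulrDl mul1r /u; lra.
pose Z a := F (n%:Z * a) z; pose gamma t := F (n%:Z * k t) (c (u t)).
have ZE a b : a <= b -> mdist (Z a) (Z b) = b%:~R * l - a%:~R * l.
  move=> ab; rewrite (displacementE fK fiK f_isom) -mulrBr -[b - a]gez0_abs ?subr_ge0//.
  by rewrite additive dn -mulrBl -rmorphB /= pmulrn gez0_abs ?subr_ge0.
have Zl t : mdist (Z (k t)) (gamma t) = u t.
  have /andP[u0 ul] := u_itv t.
  rewrite (zpow_isometric fiK f_isom) -c0 c_geod ?lexx ?u0 ?(ltW l0) ?(ltW ul)//.
  by rewrite sub0r normrN ger0_norm.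
have Zr t : mdist (gamma t) (Z (k t + 1)) = l - u t.
  have /andP[u0 ul] := u_itv t.
  rewrite /Z mulrDr mulr1 (zpowD fK fiK) (zpow_isometric fiK f_isom) /= -cl.
  rewrite c_geod ?lexx ?u0 ?(ltW l0) ?(ltW ul)//.
  by rewrite distrC ger0_norm// subr_ge0 ltW.
exists gamma; split=> [s t|t]; last first.
  have kE : k (t + l) = k t + 1.
    by rewrite /k mulrDl divff ?gt_eqF// floorDrz// floor1.
  rewrite /gamma -(zpowD_nat fiK) kE mulrDr mulr1; congr (F _ (c _)).
  by rewrite /u kE intrD1; lra.
wlog st : s t / s <= t => [H|].
  case: (leP s t) => [|/ltW] st; first exact: H.
  by rewrite metric_sym distrC; apply: H.
have kst : k s <= k t by apply: le_floor; rewrite ler_pM2r// invr_gt0.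
have := u_itv s; have := u_itv t => /andP[ut0 utl] /andP[us0 usl].
rewrite distrC [RHS]ger0_norm ?subr_ge0//.
move: kst; rewrite le_eqVlt => /orP[/eqP kE|klt].
  rewrite /gamma kE (zpow_isometric fiK f_isom).
  rewrite c_geod ?us0 ?ut0 ?(ltW usl) ?(ltW utl)//.
  have uE : u t - u s = t - s by rewrite /u kE; lra.
  by rewrite distrC uE ger0_norm// subr_ge0.
have k1 : k s + 1 <= k t by lia.
have d1 := ZE _ _ k1.
have k2 : k s <= k t + 1 by lia.
have d2 := ZE _ _ k2.
have t1 := metric_triangle (gamma s) (Z (k s + 1)) (gamma t).
have t2 := metric_triangle (Z (k s + 1)) (Z (k t)) (gamma t).
have t3 := metric_triangle (Z (k s)) (gamma s) (Z (k t + 1)).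
have t4 := metric_triangle (gamma s) (gamma t) (Z (k t + 1)).
move: d1 d2 t1 t2 t3 t4; rewrite !Zl !Zr !intrD1 !mulrDl !mul1r /u.
by move=> *; apply/eqP; rewrite eq_le; apply/andP; split; lra.
Qed.

End InvariantGeodesic.

(** * Rays in hyperbolic spaces *)

Section RaysInHyperbolicSpaces.
Context {R : realType} {X : metricType R} (delta : R).
Context (four_point : gromov_four_point X delta).
Implicit Types (x y z p o : X) (r : R -> X).

Lemma gromov_product_min x y z p :
  gromov_product x z p - delta <= gromov_product x y p \/
  gromov_product y z p - delta <= gromov_product x y p.
Proof.
have := four_point x y z p.
by case: (leP (gromov_product x z p)) => _; [left|right].
Qed.

Lemma four_point_ge0 o : 0 <= delta.
Proof.
have := gromov_product_min o o o o.
by rewrite /gromov_product mdistxx; case; lra.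
Qed.

Lemma ray_dist r s t : geodesic_ray r -> 0 <= s <= t -> mdist (r s) (r t) = t - s.
Proof.
move=> rG /andP[s0 st].
by rewrite rG ?(le_trans s0)// distrC ger0_norm// subr_ge0.
Qed.

(** If the products were unbounded, the four-point inequality would make the
    two rays stay within bounded distance of each other at all equal times. *)
Lemma gromov_product_ray_bounded r1 r2 o :
  geodesic_ray r1 -> geodesic_ray r2 ->
  ~ finite_hausdorff_distance (ray_image r1) (ray_image r2) ->
  exists D, forall s t, 0 <= s -> 0 <= t -> gromov_product (r1 s) (r2 t) o <= D.
Proof.
move=> G1 G2 far; apply: contrapT => /forallNP unbounded; apply: far.
have delta0 := four_point_ge0 o.
pose A := mdist (r1 0) o; pose B := mdist (r2 0) o.
have A0 : 0 <= A by exact: mdist_ge0.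
have B0 : 0 <= B by exact: mdist_ge0.
suff close u : 0 <= u -> mdist (r1 u) (r2 u) <= 3 * A + 3 * B + 4 * delta.
  exists (3 * A + 3 * B + 4 * delta); split=> _ [u u0 <-].
    by exists (r2 u); [exists u|exact: close].
  by exists (r1 u); [exists u|rewrite metric_sym; exact: close].
move=> u0.
have [s [t [s0 t0 large]]] : exists s t, [/\ 0 <= s, 0 <= t &
    u + A + B < gromov_product (r1 s) (r2 t) o].
  apply: contrapT => no; apply: (unbounded (u + A + B)) => s t s0 t0.
  by rewrite leNgt; apply/negP => lt; apply: no; exists s, t.
have R1 v w : 0 <= v <= w -> _ := @ray_dist r1 v w G1.
have R2 v w : 0 <= v <= w -> _ := @ray_dist r2 v w G2.
have ds : mdist (r1 0) (r1 s) = s - 0 by rewrite R1// lexx.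
have dt : mdist (r2 0) (r2 t) = t - 0 by rewrite R2// lexx.
have us : u <= s.
  have := metric_triangle (r1 s) (r1 0) o.
  have := metric_triangle (r2 t) (r1 s) o.
  rewrite (metric_sym (r2 t) (r1 s)) (metric_sym (r1 s) (r1 0)).
  by move: large; rewrite /gromov_product -/A; lra.
have ut : u <= t.
  have := metric_triangle (r2 t) (r2 0) o.
  have := metric_triangle (r1 s) (r2 t) o.
  rewrite (metric_sym (r2 t) (r2 0)).
  by move: large; rewrite /gromov_product -/B; lra.
have dus : mdist (r1 u) (r1 s) = s - u by rewrite R1// u0.
have dut : mdist (r2 u) (r2 t) = t - u by rewrite R2// u0.
have d0u1 : mdist (r1 0) (r1 u) = u - 0 by rewrite R1// lexx.
have d0u2 : mdist (r2 0) (r2 u) = u - 0 by rewrite R2// lexx.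
have := gromov_product_min (r1 u) (r2 u) (r1 s) o.
have := gromov_product_min (r2 u) (r1 s) (r2 t) o.
have := metric_triangle (r1 u) o (r1 0).
have := metric_triangle (r1 u) (r1 0) o.
have := metric_triangle (r2 u) o (r2 0).
have := metric_triangle (r2 u) (r2 0) o.
have := metric_triangle (r1 0) o (r1 s).
have := metric_triangle (r2 0) o (r2 t).
move: large; rewrite /gromov_product (metric_sym o (r1 0)) (metric_sym o (r2 0)).
rewrite (metric_sym o (r1 s)) (metric_sym o (r2 t)).
rewrite (metric_sym (r1 u) (r1 0)) (metric_sym (r2 u) (r2 0)) -/A -/B.
rewrite ds dt dus dut d0u1 d0u2.
by move=> large t1 t2 t3 t4 t5 t6 [m1|m1] [m2|m2]; lra.
Qed.

(** A small product means that [p] is almost on a geodesic from [o] to [r S];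
    it is then close to the point of the ray at the same distance from [o]. *)
Lemma near_ray r o p E S :
  geodesic_ray r -> mdist o p <= S -> gromov_product (r S) o p <= E ->
  mdist p (r (mdist o p)) <= 2 * E + mdist (r 0) o + 2 * delta.
Proof.
set u := mdist o p => rG uS.
have u0 : 0 <= u by exact: mdist_ge0.
have dS : mdist (r 0) (r S) = S - 0 by rewrite ray_dist// lexx (le_trans u0).
have du : mdist (r 0) (r u) = u - 0 by rewrite ray_dist// lexx.
have duS : mdist (r u) (r S) = S - u by rewrite ray_dist// u0.
have := metric_triangle (r 0) o (r S).
have := metric_triangle (r u) (r 0) o.
have := metric_triangle (r S) p o.
have := gromov_product_min p (r u) (r S) o.
rewrite /gromov_product (metric_sym (r u) (r 0)) dS du duS.
rewrite (metric_sym p o) (metric_sym o (r S)) (metric_sym (r S) p) -/u.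
by move=> [m|m] *; lra.
Qed.

(** The bound does not involve the Hausdorff distances between the rays and
    their images: these only determine how far out on the rays the endpoints
    [r1 S] and [r2 S] have to be taken. *)
Lemma isometric_image_near_rays (phi : X -> X) r1 r2 o D :
  (forall x y, mdist (phi x) (phi y) = mdist x y) ->
  geodesic_ray r1 -> geodesic_ray r2 ->
  (forall s t, 0 <= s -> 0 <= t -> gromov_product (r1 s) (r2 t) o <= D) ->
  finite_hausdorff_distance (ray_image r1) (ray_image (phi \o r1)) ->
  finite_hausdorff_distance (ray_image r2) (ray_image (phi \o r2)) ->
  exists u, 0 <= u /\
    (mdist (phi o) (r1 u) <= 2 * D + 8 * delta + mdist (r1 0) o \/
     mdist (phi o) (r2 u) <= 2 * D + 8 * delta + mdist (r2 0) o).
Proof.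
move=> phi_isom G1 G2 bounded [H1 [near1 _]] [H2 [near2 _]].
set p := phi o; pose S := mdist o p + mdist (r1 0) o + mdist (r2 0) o +
  `|H1| + `|H2| + `|D| + 2 * `|delta| + 1.
have uS : mdist o p <= S.
  have := mdist_ge0 (r1 0) o; have := mdist_ge0 (r2 0) o.
  have := normr_ge0 H1; have := normr_ge0 H2.
  by have := normr_ge0 D; have := normr_ge0 delta; rewrite /S; lra.
have S0 : 0 <= S by rewrite (le_trans _ uS)// mdist_ge0.
have [_ [s /= s0 <-] ds] := near1 (r1 S) (ex_intro2 _ _ S S0 erefl).
have [_ [t /= t0 <-] dt] := near2 (r2 S) (ex_intro2 _ _ S S0 erefl).
have st : gromov_product (phi (r1 s)) (phi (r2 t)) p <= D.
  by rewrite /gromov_product /p !phi_isom; exact: bounded.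
have dS1 : mdist (r1 0) (r1 S) = S - 0 by rewrite ray_dist// lexx.
have dS2 : mdist (r2 0) (r2 S) = S - 0 by rewrite ray_dist// lexx.
(* The points [r1 S] and [phi (r1 s)] have a large product at [p], as do [r2 S]
   and [phi (r2 t)], so the bound on the images passes to [r1 S] and [r2 S]. *)
have SS : gromov_product (r1 S) (r2 S) p <= D + 2 * delta.
  have := gromov_product_min (phi (r1 s)) (phi (r2 t)) (r1 S) p.
  have := gromov_product_min (phi (r2 t)) (r1 S) (r2 S) p.
  have := metric_triangle (r1 0) o (r1 S).
  have := metric_triangle (r2 0) o (r2 S).
  have := metric_triangle o p (r1 S).
  have := metric_triangle o p (r2 S).
  have := metric_triangle (r1 S) (phi (r1 s)) p.
  have := metric_triangle (r2 S) (phi (r2 t)) p.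
  have := ler_norm H1; have := ler_norm H2.
  have := ler_norm D; have := ler_norm delta.
  move: st ds dt => /=; rewrite /gromov_product dS1 dS2.
  rewrite (metric_sym p (r1 S)) (metric_sym p (r2 S)).
  rewrite (metric_sym (phi (r1 s)) (r1 S)) (metric_sym (phi (r2 t)) (r2 S)).
  have := normr_ge0 H1; have := normr_ge0 H2.
  have := normr_ge0 D; have := normr_ge0 delta.
  have A0 := mdist_ge0 (r1 0) o; have B0 := mdist_ge0 (r2 0) o.
  have SE : S = mdist o p + mdist (r1 0) o + mdist (r2 0) o +
    `|H1| + `|H2| + `|D| + 2 * `|delta| + 1 by [].
  move=> n1 n2 n3 n4 st ds dt l1 l2 l3 l4 t1 t2 t3 t4 t5 t6.
  by move=> [m1|m1] [m2|m2]; lra.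
exists (mdist o p); split; first exact: mdist_ge0.
case: (gromov_product_min (r1 S) (r2 S) o p) => m; [left|right].
  by have := @near_ray r1 o p (D + 3 * delta) S G1 uS; lra.
by have := @near_ray r2 o p (D + 3 * delta) S G2 uS; lra.
Qed.

End RaysInHyperbolicSpaces.

(** * The metric of a graph *)

Section GraphMetric.
Context {R : realType} {G : graph} (cG : connected_graph G).
Local Notation X := (realization R cG).
Local Notation coord := Defs.coord.
Local Notation vtx := (@vertex_point R G cG).
Implicit Types (x y z : X) (u v w : G).

Lemma coord_vtx u w : coord (vtx u) w = (w == u)%:R.
Proof. by rewrite /= /bary subr0 mul1r mul0r addr0. Qed.

Lemma coord_ge0 x w : 0 <= coord x w.
Proof.
have [u [v [t [_ /andP[t0 t1] ->]]]] := coordP x.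
by rewrite /bary addr_ge0// mulr_ge0// subr_ge0.
Qed.

Lemma coord_eq1 x w : coord x w = 1 -> x = vtx w.
Proof.
have [u [v [t [_ _ xE]]]] := coordP x; rewrite xE /bary => w1.
apply: coord_inj; rewrite xE /=.
have [uv|uv] := eqVneq u v.
  move: w1; rewrite -uv baryxx -mulrDl subrK mul1r.
  by case: eqVneq => [->//|_ /esym/eqP]; rewrite oner_eq0.
move: w1; have [->|wu] := eqVneq w u.
  rewrite (negbTE uv) mulr1 mulr0 addr0 => t1.
  by rewrite (_ : t = 0) ?bary0//; lra.
have [->|wv] := eqVneq w v; last first.
  by rewrite !mulr0 addr0 => /esym/eqP; rewrite oner_eq0.
by rewrite mulr0 mulr1 add0r => ->; rewrite bary1.
Qed.

Lemma edge_segment_dist x y l : edge_segment x y l -> mdist x y <= l.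
Proof.
by move=> e; apply: path_metric_le; rewrite -[l]addr0; apply: PathCons e (PathNil _).
Qed.

Lemma adj_dist u v : adj u v -> mdist (vtx u) (vtx v) <= 1.
Proof.
move=> uv; apply: edge_segment_dist; exists u, v, 0, 1; split=> //.
by rewrite sub0r normrN1 !lexx ler01 /= (bary0 R u v) bary1; split.
Qed.

Lemma path_dist u p : path (@adj G) u p ->
  mdist (vtx u) (vtx (last u p)) <= (size p)%:R.
Proof.
elim: p u => [|v p IH] u /=; first by rewrite mdistxx.
move=> /andP[uv /IH pv].
rewrite (le_trans (metric_triangle _ (vtx v) _))// -natr1 addrC.
by rewrite lerD// adj_dist.
Qed.

Lemma dist_support x w : 0 < coord x w -> mdist x (vtx w) <= 1 - coord x w.
Proof.
have [u [v [t [uv t01 xE]]]] := coordP x.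
have [uEv|uDv] := eqVneq u v.
  have -> : x = vtx u by apply: coord_inj; rewrite xE -uEv baryxx.
  rewrite coord_vtx; have [->|] := eqVneq w u; last by rewrite ltxx.
  by rewrite mdistxx subrr.
case: uv => [/eqP|uv]; first by rewrite (negbTE uDv).
have /andP[t0 t1] := t01; rewrite xE /bary.
have [->|wu] := eqVneq w u.
  move=> _; rewrite (negbTE uDv) mulr1 mulr0 addr0 subKr.
  apply: edge_segment_dist; exists u, v, t, 0; split=> //.
  by rewrite t01 lexx ler01 /= (bary0 R u v) subr0 ger0_norm//; split.
have [->|wv] := eqVneq w v; last by rewrite !mulr0 addr0 ltxx.
move=> _; rewrite mulr0 mulr1 add0r.
apply: edge_segment_dist; exists u, v, t, 1; split=> //.
by rewrite t01 lexx ler01 /= bary1 distrC ger0_norm ?subr_ge0//; split.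
Qed.

(** A point inside an edge has both ends of the edge in its support, so a
    vertex can only be gained by starting at the other end. *)
Lemma edge_support x y k w : edge_segment x y k -> 0 < coord y w ->
  ~~ (0 < coord x w) -> exists w', adj w' w /\ x = vtx w'.
Proof.
move=> [u [v [s [t [uv [/andP[s0 s1] _ xE yE _]]]]]].
have uDv : u != v by apply/eqP => uv'; move: uv; rewrite uv' adj_irrefl.
rewrite xE yE /bary; have [->|wu] := eqVneq w u.
  rewrite (negbTE uDv) !mulr1 !mulr0 !addr0 => _; rewrite -leNgt => s1'.
  have sE : s = 1 by lra.
  exists v; split; first by rewrite adj_sym.
  by apply: coord_inj; rewrite xE sE bary1.
have [->|wv] := eqVneq w v; last by rewrite !mulr0 !addr0 ltxx.
rewrite !mulr1 !mulr0 !add0r => _; rewrite -leNgt => s0'.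
have sE : s = 0 by lra.
by exists u; split=> //; apply: coord_inj; rewrite xE sE bary0.
Qed.

(** For [w] in the support, [1 - coord x w] is the length of the part of the
    edge between [x] and [w]; with [phi] a distance to a target, this is the
    step of an induction along polygonal paths: every path to the target leaves
    the edge of [x] through one of its ends. *)
Lemma edge_support_le (phi : G -> R) x y k l w :
  (forall u v, adj u v -> phi u <= phi v + 1) ->
  edge_segment x y k -> 0 < coord y w -> 1 - coord y w + phi w <= l ->
  exists w', 0 < coord x w' /\ 1 - coord x w' + phi w' <= k + l.
Proof.
move=> phi_lip e yw wl.
have ew : `|coord x w - coord y w| <= k.
  by rewrite -[k]addr0; apply: coord_lip; apply: PathCons e (PathNil _).
have [xw|xw] := boolP (0 < coord x w).
  exists w; split=> //; have := ler_norm (coord y w - coord x w).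
  by rewrite distrC; lra.
have [w' [w'w xE]] := edge_support e yw xw.
exists w'; rewrite {1 2}xE coord_vtx eqxx subrr add0r; split=> //.
have := ler_norm (coord y w - coord x w); rewrite distrC.
have := phi_lip _ _ w'w; have := coord_ge0 x w.
by move: xw; rewrite -leNgt; lra.
Qed.

(** The minimum over the at most two vertices of the support does not depend
    on the path, so it bounds the infimum of the lengths. *)
Lemma dist_attained_support x z (phi : G -> R) :
  (forall l, polygonal_path x z l ->
    exists w, 0 < coord x w /\ 1 - coord x w + phi w <= l) ->
  exists w, 0 < coord x w /\ 1 - coord x w + phi w <= mdist x z.
Proof.
move=> H.
have [u [v [t [_ _ xE]]]] := coordP x.
have supp w : 0 < coord x w -> w \in [:: u; v].
  rewrite xE /bary !inE; case: eqVneq => //= _; case: eqVneq => //= _.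
  by rewrite !mulr0 addr0 ltxx.
pose C w := 1 - coord x w + phi w.
suff [w [xw wmin]] : exists w, 0 < coord x w /\
    forall w', 0 < coord x w' -> C w <= C w'.
  exists w; split=> //.
  have [l0 pl0] := polygonal_path_exists x z.
  apply: lb_le_inf; first by exists l0.
  by move=> l /H[w' [xw' w'l]]; apply: le_trans (wmin _ xw') w'l.
have [l0 /H[w0 [xw0 _]]] := polygonal_path_exists x z.
have [xu|xu] := boolP (0 < coord x u); last first.
  have w0v := supp _ xw0; exists w0; split=> // w' xw'.
  have := supp _ xw'; rewrite !inE in w0v *.
  case/orP: w0v xw0 => /eqP ->; first by rewrite (negbTE xu).
  by move=> _ /orP[/eqP w'u|/eqP->//]; move: xw'; rewrite w'u (negbTE xu).
have [xv|xv] := boolP (0 < coord x v); last first.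
  exists u; split=> // w' xw'; have := supp _ xw'; rewrite !inE.
  by case/orP => /eqP w'E; rewrite w'E//; move: xw'; rewrite w'E (negbTE xv).
have [uv|/ltW uv] := leP (C u) (C v).
  by exists u; split=> // w' /supp; rewrite !inE => /orP[]/eqP ->.
by exists v; split=> // w' /supp; rewrite !inE => /orP[]/eqP ->.
Qed.

Lemma support_neq0 x : exists w, 0 < coord x w.
Proof.
have [u [v [t [_ /andP[t0 t1] ->]]]] := coordP x; rewrite /bary.
have [uv|uv] := eqVneq u v.
  by exists u; rewrite -uv eqxx -mulrDl subrK mul1r ltr01.
have [t_gt0|t_le0] := ltP 0 t; [exists v|exists u].
  by rewrite eqxx eq_sym (negbTE uv) mulr0 add0r mulr1.
by rewrite eqxx (negbTE uv) mulr0 addr0 mulr1; lra.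
Qed.

(** Points at distance at least 2 do not lie on a common edge, so a path
    between them passes through an end of the edge of the first point. *)
Lemma dist_through_vertex x z : 2 <= mdist x z ->
  exists w, 0 < coord x w /\ 1 - coord x w + mdist (vtx w) z <= mdist x z.
Proof.
move=> xz2; pose phi w := mdist (vtx w) z.
have phi_lip u v : adj u v -> phi u <= phi v + 1.
  move=> /adj_dist uv; rewrite /phi.
  by have := metric_triangle (vtx u) (vtx v) z; lra.
apply: (@dist_attained_support _ _ phi) => l pl.
(* Once a path visits a vertex, the conclusion holds at that vertex. *)
have at_vertex y m w : polygonal_path y z m -> y = vtx w ->
    0 < coord y w /\ 1 - coord y w + phi w <= m.
  move=> p yE; rewrite yE coord_vtx eqxx ltr01 subrr add0r /phi -yE.
  by split=> //; exact: path_metric_le.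
suff [same|//] : (forall w, (0 < coord x w) = (0 < coord z w)) \/
    exists w, 0 < coord x w /\ 1 - coord x w + phi w <= l.
  have [w xw] := support_neq0 x; have zw := xw; rewrite same in zw.
  have := metric_triangle x (vtx w) z; rewrite (metric_sym (vtx w)).
  by have := dist_support xw; have := dist_support zw; lra.
rewrite {xz2}; elim: pl @phi phi_lip at_vertex => {x z l}
  [x|x y z k l e pl IH] phi phi_lip at_vertex.
  by left.
have pxz : polygonal_path x z (k + l) by exact: PathCons e pl.
have [/existsNP[w]|xy] := pselect (~ forall w, (0 < coord x w) = (0 < coord y w)).
  have [xw|xw] := boolP (0 < coord x w); have [yw|yw] := boolP (0 < coord y w) => // _.
    have [w' [_ yE]] := edge_support (edge_segment_sym e) xw yw.
    right; have [yw' w'l] := at_vertex _ _ _ pl yE.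
    exact: edge_support_le phi_lip e yw' w'l.
  have [w' [_ xE]] := edge_support e yw xw.
  by right; exists w'; exact: at_vertex.
move/contrapT: xy => xy.
case: (IH phi_lip at_vertex) => [yz|[w [yw wl]]].
  by left => w; rewrite xy yz.
by right; exact: edge_support_le phi_lip e yw wl.
Qed.

Definition vertex_dist_spec u v n :=
  `[< exists p, [/\ path (@adj G) u p, last u p = v & size p = n] >].

Lemma vertex_dist_ex u v : exists n, vertex_dist_spec u v n.
Proof. by have [p pu pv] := cG u v; exists (size p); apply/asboolP; exists p. Qed.

Definition vertex_dist u v := ex_minn (vertex_dist_ex u v).

Lemma vertex_distP u v : exists p,
  [/\ path (@adj G) u p, last u p = v & size p = vertex_dist u v].
Proof. by rewrite /vertex_dist; case: ex_minnP => n /asboolP. Qed.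

Lemma vertex_dist_le u p : path (@adj G) u p ->
  (vertex_dist u (last u p) <= size p)%N.
Proof.
move=> up; rewrite /vertex_dist; case: ex_minnP => n _; apply.
by apply/asboolP; exists p.
Qed.

Lemma dist_vertexE x u : exists w, 0 < coord x w /\
  mdist x (vtx u) = 1 - coord x w + (vertex_dist w u)%:R.
Proof.
have [|w [xw wx]] := @dist_attained_support x (vtx u) (fun w => (vertex_dist w u)%:R).
  move=> l; move zE : (vtx u) => z pl; elim: pl zE => {x z l} [x|x y z k l e pl IH] zE.
    exists u; rewrite -zE coord_vtx eqxx ltr01 subrr add0r.
    by have := @vertex_dist_le u [::] isT; rewrite leqn0 => /eqP ->.
  have [w [yw wl]] := IH zE.
  apply: (edge_support_le (phi := fun w => (vertex_dist w u)%:R)) e yw wl.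
  move=> v v' vv'; have [p [pv' pu <-]] := vertex_distP v' u.
  rewrite natr1 ler_nat -pu.
  by apply: (@vertex_dist_le v (v' :: p)); rewrite /= vv'.
exists w; split=> //; apply/eqP; rewrite eq_le wx andbT.
rewrite (le_trans (metric_triangle _ (vtx w) _))// lerD ?dist_support//.
by have [p [pw <- <-]] := vertex_distP w u; exact: path_dist.
Qed.

Lemma dist_vertices u v : mdist (vtx u) (vtx v) = (vertex_dist u v)%:R.
Proof.
have [w []] := dist_vertexE (vtx u) v.
rewrite coord_vtx; have [->|_] := eqVneq w u; last by rewrite ltxx.
by rewrite subrr add0r.
Qed.

(** The distance from a vertex to a point inside an edge differs from an
    integer by the distance from the point to an end of that edge. *)
Lemma vertex_of_integral_dist u x (n : nat) :
  mdist (vtx u) x = n%:R -> exists v, x = vtx v.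
Proof.
rewrite metric_sym; have [w [xw ->]] := dist_vertexE x u => E.
have x1 : coord x w <= 1.
  by have := dist_support xw; have := mdist_ge0 x (vtx w); lra.
exists w; apply: coord_eq1.
have : (vertex_dist w u < n.+1)%N by rewrite -(ltr_nat R) -natr1; lra.
rewrite ltnS leq_eqVlt => /orP[/eqP nE|]; first by move: E; rewrite nE; lra.
by rewrite -(ler_nat R) -natr1; lra.
Qed.

Lemma ball_finite u (n : nat) : locally_finite G ->
  finite_set [set v | (vertex_dist u v <= n)%N].
Proof.
move=> fin; elim: n => [|n IH].
  apply: (sub_finite_set (B := [set u])); last exact: finite_set1.
  move=> v /=; rewrite leqn0; have [p [_ <- <-]] := vertex_distP u v.
  by move/nilP => ->.
apply: (@sub_finite_set _ _ ([set u] `|`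
    \bigcup_(w in [set v | (vertex_dist u v <= n)%N]) [set v | adj w v])).
  move=> v /=; have [p [pu <- <-]] := vertex_distP u v.
  case/lastP: p pu => [|p w]; first by left.
  rewrite last_rcons size_rcons ltnS rcons_path => /andP[pu pw] pn.
  right; exists (last u p) => //=.
  exact: leq_trans (vertex_dist_le pu) pn.
by rewrite finite_setU; split; [exact: finite_set1|exact: bigcup_finite].
Qed.

(** Some vertex [w] lies on a geodesic from [r 0] to [r 3], hence on geodesics
    from [r 0] to all later points.  The ray itself might avoid [w], but its
    points at integral distance from [w] are vertices. *)
Lemma ray_meets_vertices (r : R -> X) : geodesic_ray r ->
  exists t0, [/\ 0 <= t0 & forall n : nat, exists v, r (t0 + n%:R) = vtx v].
Proof.
move=> rG.
have r03 : mdist (r 0) (r 3) = 3 by rewrite rG// sub0r normrN ger0_norm.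
have [|w [xw wr]] := @dist_through_vertex (r 0) (r 3); first by rewrite r03; lra.
rewrite r03 in wr; have dw := dist_support xw; set s := 1 - coord (r 0) w in wr dw.
have s0 : 0 <= s by exact: le_trans (mdist_ge0 _ _) dw.
exists (s + 3); split; first by lra.
move=> n; apply: (@vertex_of_integral_dist w _ (n + 3)).
have n0 : 0 <= n%:R :> R by rewrite ler0n.
have := metric_triangle (vtx w) (r 3) (r (s + 3 + n%:R)).
have := metric_triangle (r 0) (vtx w) (r (s + 3 + n%:R)).
have t0 : 0 <= s + 3 + n%:R by lra.
rewrite !rG// sub0r normrN ger0_norm// distrC ger0_norm; last by lra.
by rewrite natrD; lra.
Qed.

End GraphMetric.

(** * Boundary points and elliptic isometries *)

Section BoundaryPoints.
Context {R : realType} {X : metricType R}.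
Implicit Types (A B C : set X) (r : R -> X) (f : X -> X).

Lemma finite_hausdorff_refl A : finite_hausdorff_distance A A.
Proof. by exists 0; split=> x Ax; exists x; rewrite ?mdistxx. Qed.

Lemma finite_hausdorff_sym A B :
  finite_hausdorff_distance A B -> finite_hausdorff_distance B A.
Proof. by move=> [K [AB BA]]; exists K. Qed.

Lemma finite_hausdorff_trans A B C : finite_hausdorff_distance A B ->
  finite_hausdorff_distance B C -> finite_hausdorff_distance A C.
Proof.
move=> [K [AB BA]] [L [BC CB]]; exists (K + L); split=> [x /AB|x /CB] [y].
- move=> /BC[z Cz yz] xy; exists z => //.
  by have := metric_triangle x y z; lra.
- move=> /BA[z Az yz] xy; exists z => //.
  by have := metric_triangle x y z; lra.
Qed.

Lemma ray_class_eq r1 r2 :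
  finite_hausdorff_distance (ray_image r1) (ray_image r2) ->
  ray_class r1 = ray_class r2.
Proof.
move=> r12; apply/seteqP; split=> r [rG]; split=> //.
  exact: finite_hausdorff_trans (finite_hausdorff_sym r12) _.
exact: finite_hausdorff_trans r12 _.
Qed.

Lemma fixed_boundary_iter f r (k : nat) : geodesic_ray r ->
  boundary_map f (ray_class r) = ray_class r ->
  finite_hausdorff_distance (ray_image r) (ray_image (iter k f \o r)).
Proof.
move=> rG fix_r; suff [] : ray_class r (iter k f \o r) by [].
elim: k => [|k IH]; first by split=> //; exact: finite_hausdorff_refl.
by rewrite -fix_r; exists (iter k f \o r).
Qed.

Lemma periodic_elliptic f z n : injective f -> (0 < n)%N -> iter n f z = z ->
  elliptic f.
Proof.
move=> f_inj n0 fz.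
have fmul k : iter (k * n) f z = z.
  by elim: k => //= k IH; rewrite mulSn iterD IH.
have orbitE y : orbitZ f z y -> exists2 j, (j < n)%N & y = iter j f z.
  suff : orbitZ f z y -> exists j, y = iter j f z.
    move=> H /H[j ->]; exists (j %% n)%N; first by rewrite ltn_mod.
    by rewrite {1}(divn_eq j n) addnC iterD fmul.
  move=> [i [->|zE]]; first by exists i.
  exists (i * n - i)%N; have : iter i f y = iter i f (iter (i * n - i) f z).
    by rewrite -iterD subnKC ?fmul// leq_pmulr.
  have iter_inj j : injective (iter j f) by elim: j => // j IH u v /f_inj/IH.
  exact: iter_inj.
pose M := \sum_(j < n) mdist z (iter j f z).
have bound y : orbitZ f z y -> mdist z y <= M.
  move=> /orbitE[j jn ->]; rewrite /M (bigD1 (Ordinal jn))//= lerDl.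
  by apply: sumr_ge0 => i _; exact: mdist_ge0.
exists z, (M + M) => x y /bound zx /bound zy.
by have := metric_triangle x z y; rewrite (metric_sym x z); lra.
Qed.

End BoundaryPoints.

(** * Axes of hyperbolic automorphisms *)

Section VertexAction.
Context {R : realType} {G : graph} (cG : connected_graph G).
Local Notation vtx := (@vertex_point R G cG).

Lemma aut_action_vtx (h : automorphism G) u :
  aut_action R cG h (vtx u) = vtx (h u).
Proof. by apply: coord_inj => /=; rewrite bary_aut. Qed.

Lemma zpow_aut_vtx (h : automorphism G) (a : int) u : exists v,
  zpow (aut_action R cG h) (aut_action R cG (automorphism_inv h)) a (vtx u)
    = vtx v.
Proof.
have iter_vtx (h' : automorphism G) n : exists v,
    iter n (aut_action R cG h') (vtx u) = vtx v.
  elim: n => [|n [v vE]]; first by exists u.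
  by exists (h' v); rewrite /= vE aut_action_vtx.
by case: a => n; exact: iter_vtx.
Qed.

End VertexAction.

Theorem theorem3p1 (R : realType) (G : graph) (cG : connected_graph G)
    (delta : R) (g : automorphism G) :
  locally_finite G ->
  hyperbolic_space (realization R cG) delta ->
  hyperbolic_isometry (aut_action R cG g) ->
  exists (gamma : R -> realization R cG) (n : nat),
    [/\ bi_infinite_geodesic gamma, (0 < n)%N &
      exists l : R, forall t : R,
        iter n (aut_action R cG g) (gamma t) = gamma (t + l)].
Proof.
move=> fin [_ geodesic _ four_point] [[f_isom _] not_elliptic [a [b [ab fixE]]]].
set f := aut_action R cG g in f_isom not_elliptic fixE *.
pose fi := aut_action R cG (automorphism_inv g).
have fK : cancel f fi := aut_actionK g.
have fiK : cancel fi f := aut_actionVK g.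
have f_free z n : (0 < n)%N -> iter n f z <> z.
  by move=> n0 fz; apply: not_elliptic; exact: periodic_elliptic (can_inj fK) n0 fz.
have fixedP xi : xi = a \/ xi = b -> boundary xi /\ boundary_map f xi = xi.
  by have := congr1 (@^~ xi) fixE => /= ->.
have [[r1 G1 aE] fix_a] : boundary a /\ boundary_map f a = a.
  by apply: fixedP; left.
have [[r2 G2 bE] fix_b] : boundary b /\ boundary_map f b = b.
  by apply: fixedP; right.
subst a b.
have far : ~ finite_hausdorff_distance (ray_image r1) (ray_image r2).
  by move=> /ray_class_eq.
have [t1 [t1_ge0 vtx1]] := ray_meets_vertices G1.
have [t2 [t2_ge0 vtx2]] := ray_meets_vertices G2.
have [u0 _] := vtx1 0%N; pose o := vertex_point R cG u0 : realization R cG.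
have [D bounded] := gromov_product_ray_bounded four_point o G1 G2 far.
pose q (e : bool) (m : nat) := if e then r1 (t1 + m%:R) else r2 (t2 + m%:R).
have q_geod e i j : mdist (q e i) (q e j) = `|i%:R - j%:R|.
  rewrite /q; case: e; rewrite ?G1 ?G2 ?addr_ge0//; congr `|_|; lra.
have q_vtx e m : exists v, q e m = vertex_point R cG v.
  by rewrite /q; case: e.
pose K := `|2 * D + 8 * delta| + mdist (r1 0) o + mdist (r2 0) o + t1 + t2 + 1.
(* The nearest ray point is [r u]; replacing [u] by the place of a vertex,
   [t1] or [t2] plus the integral part of [u], costs at most [t1 + t2 + 1]. *)
have near_q (k : nat) : exists e m, mdist (iter k f o) (q e m) <= K.
  have iter_isom x y : mdist (iter k f x) (iter k f y) = mdist x y.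
    by elim: k => //= k <-; rewrite f_isom.
  have [u [u_ge0 near]] := isometric_image_near_rays four_point iter_isom G1 G2
    bounded (fixed_boundary_iter k G1 fix_a) (fixed_boundary_iter k G2 fix_b).
  have /andP[mu um] := truncn_itv u_ge0; rewrite -natr1 in um.
  have m_ge0 : 0 <= (Num.truncn u)%:R :> R by rewrite ler0n.
  have A_ge0 := mdist_ge0 (r1 0) o; have B_ge0 := mdist_ge0 (r2 0) o.
  have C_le := ler_norm (2 * D + 8 * delta).
  have step t : 0 <= t -> `|u - (t + (Num.truncn u)%:R)| <= t + 1.
    by move=> t_ge0; rewrite ler_norml; apply/andP; split; lra.
  case: near => near; [exists true|exists false]; exists (Num.truncn u).
    have := metric_triangle (iter k f o) (r1 u) (r1 (t1 + (Num.truncn u)%:R)).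
    rewrite (G1 u) ?addr_ge0// /K.
    by have := step _ t1_ge0; lra.
  have := metric_triangle (iter k f o) (r2 u) (r2 (t2 + (Num.truncn u)%:R)).
  rewrite (G2 u) ?addr_ge0// /K.
  by have := step _ t2_ge0; lra.
have /(finite_image (@vertex_point R G cG))/finite_seqP[s sE] :=
  ball_finite cG u0 (Num.truncn K) fin.
have [|z [n [n0 additive]]] :=
    displacementMn_two_rays fK fiK f_isom f_free (s := s) q_geod.
  move=> k; have [e [m km]] := near_q k.
  have [w qE] := q_vtx e m.
  have [v vE] := zpow_aut_vtx (R := R) cG g (- k%:Z) w.
  have Fv : zpow f fi k%:Z (vertex_point R cG v) = q e m.
    by rewrite -vE -(zpowD fK fiK) subrr qE.
  exists e, (vertex_point R cG v), m; split=> //.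
  have ov : mdist o (vertex_point R cG v) <= K.
    by rewrite -(zpow_isometric fiK f_isom k%:Z) Fv.
  suff : [set` s] (vertex_point R cG v : realization R cG) by [].
  rewrite -sE; exists v => //=.
  by rewrite truncn_ge_nat ?(le_trans _ ov) ?mdist_ge0// -dist_vertices.
have [c [l c_seg]] := geodesic z (iter n f z).
have l_gt0 : 0 < l.
  case: c_seg => l_ge0 c0 cl c_isom.
  rewrite lt_neqAle l_ge0 andbT; apply/eqP => l0.
  by apply: (f_free z n n0); rewrite -cl -l0 c0.
have [gamma [gamma_geod gamma_tr]] :=
  translated_geodesic fK fiK f_isom l_gt0 c_seg additive.
by exists gamma, n; split=> //; exists l.
Qed.
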